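(* Assume that a graph $G$ is a subgraph (not necessarily induced) of the strong product $P\boxtimes M$, where $P$ is a path and $M$ is a simple graph of tree-width at most $k$. Then there exists a graph $M_1$ of clique-width at most $\ell=4\cdot8^{k+1}=2^{3k+5}$, and a graph $M_2$ of tree-width at most $3(k+1)\cdot8^{k+1}$, such that $G$ is isomorphic to induced subgraphs of each of the strong products $P\boxtimes M_1$ and $P\boxtimes M_2$. In particular, the $\mathcal P^\circ$-clique-width of $G$ is at most $\ell=2^{3k+5}$, where $\mathcal P^\circ$ denotes the class of all reflexive paths.
   Context: All graphs are finite. Simple graphs have no loops and no parallel edges; a loop graph has no parallel edges, but may have at most one loop per vertex. A reflexive path is a path with a loop added to every vertex. $G$, $M_1$, $M_2$ are simple graphs. The strong product $G_1\boxtimes G_2$ of simple graphs has vertex set $V(G_1)\times V(G_2)$, and $[u,u'],[v,v']$ are adjacent iff ($uv\in E(G_1)$ and $u'v'\in E(G_2)$) or ($u=v$ and $u'v'\in E(G_2)$) or ($uv\in E(G_1)$ and $u'=v'$). Tree-width is the usual notion (maximum bag size minus one, minimised over tree decompositions). Clique-width: the least $\ell$ such that the graph (irrespective of labels) is the value of an $\ell$-expression built with the operations: create a new vertex of label $i\in\{1,\dots,\ell\}$; disjoint union of two labelled graphs; for $i\ne j$, add all missing edges between vertices of label $i$ and vertices of label $j$; for $i\neq j$, relabel all vertices of label $i$ to label $j$. $\mathcal H$-clique-width, for a family $\mathcal H$ of loop graphs: for $H\in\mathcal H$ and an integer $\ell>0$, an $(H,\ell)$-expression is an algebraic expression on graphs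 whose vertices carry labels $(i,v)$ with $i\in\{1,\dots,\ell\}$ and $v\in V(H)$, using the operations: create a new vertex with a single label $(i,v)$; disjoint union of two labelled graphs; for $1\le i\ne j\le\ell$, add all edges between the vertices of label $(i,v)$ and the vertices of label $(j,w)$ over all pairs $(v,w)\in V(H)\times V(H)$ with $vw\in E(H)$ (including $v=w$ when $v$ has a loop in $H$); for $1\le i\neq j\le\ell$, relabel every vertex with label $(i,v)$, $v\in V(H)$, to $(j,v)$. The $\mathcal H$-clique-width of a simple graph $G$ is the smallest $\ell$ such that (some labelling of) $G$ is the value of an $(H,\ell)$-expression for some $H\in\mathcal H$, and $\infty$ if there is no such $\ell$. *)

(* Defs.v *)
From HB Require Import structures.
#[warnings="-notation-overridden"] From mathcomp Require Import all_boot.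

Set Implicit Arguments.
Unset Strict Implicit.
Unset Printing Implicit Defensive.

(** * Graphs *)

Record lgraph := LGraph {
  vertex :> finType;
  edge : rel vertex;
  edge_sym : symmetric edge }.

Record sgraph := SGraph {
  sgraph_lgraph :> lgraph;
  edge_irr : irreflexive (@edge sgraph_lgraph) }.

Definition iso (G H : lgraph) : Prop :=
  exists2 f : G -> H, bijective f & forall x y, edge (f x) (f y) = edge x y.

(* Containment of graphs is understood up to renaming of the vertices. *)
Definition subgraph (G H : sgraph) : Prop :=
  exists2 f : G -> H, injective f & forall x y, edge x y -> edge (f x) (f y).

Section Induced.
Variables (G : sgraph) (A : {set G}).
Definition induced_edge : rel {x | x \in A} :=
  [rel x y | edge (val x) (val y)].
Lemma induced_sym : symmetric induced_edge.
Proof. by move=> x y; apply: edge_sym. Qed.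
Lemma induced_irr : irreflexive induced_edge.
Proof. by move=> x; apply: edge_irr. Qed.
Definition induced : sgraph := @SGraph (LGraph induced_sym) induced_irr.
End Induced.

Definition iso_induced_subgraph (G H : sgraph) : Prop :=
  exists A : {set H}, iso G (induced A).

Section StrongProduct.
Variables G1 G2 : sgraph.
Definition strong_edge : rel (G1 * G2) := fun a b =>
  [|| edge a.1 b.1 && edge a.2 b.2,
      (a.1 == b.1) && edge a.2 b.2
    | edge a.1 b.1 && (a.2 == b.2)].
Lemma strong_sym : symmetric strong_edge.
Proof.
move=> a b; rewrite /strong_edge (edge_sym a.1) (edge_sym a.2).
by rewrite (eq_sym a.1) (eq_sym a.2).
Qed.
Lemma strong_irr : irreflexive strong_edge.
Proof. by move=> a; rewrite /strong_edge !edge_irr !andbF. Qed.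
Definition strong_product : sgraph := @SGraph (LGraph strong_sym) strong_irr.
End StrongProduct.

Section PathGraph.
Variable n : nat.
Definition path_edge : rel 'I_n := fun i j => (i.+1 == j) || (j.+1 == i).
Lemma path_sym : symmetric path_edge.
Proof. by move=> i j; rewrite /path_edge orbC. Qed.
Lemma path_irr : irreflexive path_edge.
Proof. by move=> i; rewrite /path_edge orbb eqn_leq ltnn. Qed.
Definition path_graph : sgraph := @SGraph (LGraph path_sym) path_irr.
End PathGraph.

(* A path has at least one vertex. *)
Definition is_path (P : lgraph) : Prop := exists n, iso P (path_graph n.+1).

Section AddLoops.
Variable G : lgraph.
Definition loops_edge : rel G := fun x y => (x == y) || edge x y.
Lemma loops_sym : symmetric loops_edge.
Proof. by move=> x y; rewrite /loops_edge eq_sym edge_sym. Qed.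
Definition add_loops : lgraph := LGraph loops_sym.
End AddLoops.

Definition is_reflexive_path (H : lgraph) : Prop :=
  exists2 P : sgraph, is_path P & iso H (add_loops P).

(** * Width parameters *)

Definition is_least (W : nat -> Prop) (n : nat) : Prop :=
  W n /\ forall m, W m -> n <= m.

(* The minimum of [W] exists and is at most [n]; the minimum of an empty [W]
   is infinite, hence not at most [n]. *)
Definition least_at_most (W : nat -> Prop) (n : nat) : Prop :=
  exists2 m, is_least W m & m <= n.

(** ** Tree-width *)

Definition connected (G : sgraph) : Prop :=
  forall x y : G, connect (@edge G) x y.

Definition acyclic (G : sgraph) : Prop :=
  forall c : seq G, 2 < size c -> ~ ucycle (@edge G) c.

Definition is_tree (T : sgraph) : Prop :=
  [/\ 0 < #|{: T}|, connected T & acyclic T].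

Definition tree_decomposition (G T : sgraph) (bag : T -> {set G}) : Prop :=
  [/\ is_tree T,
      forall x : G, exists t, x \in bag t,
      forall x y : G, edge x y -> exists2 t, x \in bag t & y \in bag t
    & forall x : G, connected (induced [set t | x \in bag t])].

(* Truncated predecessor: the empty graph gets width 0 rather than -1, which is
   immaterial when comparing with a bound in [nat]. *)
Definition decomposition_width (G T : sgraph) (bag : T -> {set G}) : nat :=
  (\max_(t : T) #|bag t|).-1.

Definition tree_width_at_most (G : sgraph) : nat -> Prop :=
  least_at_most (fun w => exists (T : sgraph) (bag : T -> {set G}),
    tree_decomposition bag /\ decomposition_width bag = w).

(** ** Labelled graphs *)

Record labelled (L : Type) := Labelled {
  labelled_sgraph :> sgraph;
  label : labelled_sgraph -> L }.

Section LabelledOperations.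
Variable L : Type.

Lemma false_sym (T : Type) : symmetric (fun _ _ : T => false).
Proof. by []. Qed.
Lemma false_irr (T : Type) : irreflexive (fun _ _ : T => false).
Proof. by []. Qed.

Definition new_vertex (a : L) : labelled L :=
  @Labelled L (@SGraph (LGraph (@false_sym unit)) (@false_irr unit))
    (fun=> a).

Section Union.
Variables A B : labelled L.
Definition union_edge : rel (A + B) := fun x y =>
  match x, y with
  | inl x, inl y => edge x y
  | inr x, inr y => edge x y
  | _, _ => false
  end.
Lemma union_sym : symmetric union_edge.
Proof. by move=> [x|x] [y|y] //=; apply: edge_sym. Qed.
Lemma union_irr : irreflexive union_edge.
Proof. by move=> [x|x] /=; apply: edge_irr. Qed.
Definition disjoint_union : labelled L :=
  @Labelled L (@SGraph (LGraph union_sym) union_irr)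
    (fun x => match x with inl x => label x | inr x => label x end).
End Union.

(* All edges between a vertex of label [a] and a vertex of label [b], for
   [r a b]; irreflexivity of [r] ensures that no loop is created. *)
Section AddEdges.
Variables (r : rel L) (r_irr : irreflexive r) (A : labelled L).
Definition added_edge : rel A := fun x y =>
  [|| edge x y, r (label x) (label y) | r (label y) (label x)].
Lemma added_sym : symmetric added_edge.
Proof. by move=> x y; rewrite /added_edge edge_sym [X in _ || X]orbC. Qed.
Lemma added_irr : irreflexive added_edge.
Proof. by move=> x; rewrite /added_edge edge_irr r_irr. Qed.
Definition add_edges : labelled L :=
  @Labelled L (@SGraph (LGraph added_sym) added_irr) (@label L A).
End AddEdges.

Definition relabel (f : L -> L) (A : labelled L) : labelled L :=
  @Labelled L A (fun x => f (label x)).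

End LabelledOperations.

(** ** Clique-width *)

Section CliqueWidth.
Variable l : nat.

Inductive cw_expr : Type :=
  | CVertex of 'I_l
  | CUnion of cw_expr & cw_expr
  | CJoin (i j : 'I_l) of i != j & cw_expr
  | CRelabel (i j : 'I_l) of i != j & cw_expr.

Definition cw_rel (i j : 'I_l) : rel 'I_l := fun a b => (a == i) && (b == j).
Lemma cw_rel_irr i j : i != j -> irreflexive (cw_rel i j).
Proof. by move=> /negbTE ij a; rewrite /cw_rel; case: eqP => // ->. Qed.

Fixpoint cw_value (e : cw_expr) : labelled 'I_l :=
  match e with
  | CVertex i => new_vertex i
  | CUnion e1 e2 => disjoint_union (cw_value e1) (cw_value e2)
  | CJoin i j ij e => add_edges (cw_rel_irr ij) (cw_value e)
  | CRelabel i j _ e => relabel (fun a => if a == i then j else a) (cw_value e)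
  end.
End CliqueWidth.

Definition clique_width_at_most (G : sgraph) : nat -> Prop :=
  least_at_most (fun l => exists e : cw_expr l, iso G (cw_value e)).

(** ** Clique-width relative to a family of loop graphs *)

Section HCliqueWidth.
Variables (H : lgraph) (l : nat).

Inductive hcw_expr : Type :=
  | HVertex of 'I_l & H
  | HUnion of hcw_expr & hcw_expr
  | HJoin (i j : 'I_l) of i != j & hcw_expr
  | HRelabel (i j : 'I_l) of i != j & hcw_expr.

Definition hcw_rel (i j : 'I_l) : rel ('I_l * H) := fun a b =>
  [&& a.1 == i, b.1 == j & edge a.2 b.2].
Lemma hcw_rel_irr i j : i != j -> irreflexive (hcw_rel i j).
Proof. by move=> /negbTE ij a; rewrite /hcw_rel; case: eqP => // ->; rewrite ij. Qed.

Fixpoint hcw_value (e : hcw_expr) : labelled ('I_l * H) :=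
  match e with
  | HVertex i v => new_vertex (i, v)
  | HUnion e1 e2 => disjoint_union (hcw_value e1) (hcw_value e2)
  | HJoin i j ij e => add_edges (hcw_rel_irr ij) (hcw_value e)
  | HRelabel i j _ e =>
      relabel (fun a => if a.1 == i then (j, a.2) else a) (hcw_value e)
  end.
End HCliqueWidth.

Definition H_clique_width_at_most (HH : lgraph -> Prop) (G : sgraph) :
    nat -> Prop :=
  least_at_most (fun l => 0 < l /\
    exists2 H : lgraph, HH H & exists e : hcw_expr H l, iso G (hcw_value e)).

(* Main.v *)
From Stdlib Require Import Classical.
Require Import Defs.
From mathcomp Require Import all_boot.

Set Implicit Arguments.
Unset Strict Implicit.
Unset Printing Implicit Defensive.

(* A tree decomposition of [M] gives an elimination order in which the earlier
   neighbours [B v] of every vertex [v], in the chordal completion, form a clique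
   of size at most [k], and a colouring by [k + 1] colours injective on [v |: B v].
   Among the vertices of [G] whose positions on the path are adjacent or equal to
   that of a given one, a vertex is determined by its component in [M] and the
   residue of its position modulo 3. Both [M_1] and [M_2] are the graph
   of all triples [(v, a, S)], where [a] is a residue and [S], a set of pairs
   (colour, residue), lists the neighbours in [v |: B v]. A tree decomposition of
   [M] then becomes one of the blow-up with bags [3 * 8 ^ (k + 1)] times larger.
   For clique-width, the vertices [v] are created in the reverse of the elimination
   order, the label of an older vertex being the part of [S] not yet fulfilled
   ([8 ^ (k + 1)] labels); the copies of the vertex being created need
   [3 * 8 ^ (k + 1)] further labels. Finally, copies of [(v, a, S)] at two
   positions are never adjacent, because these are congruent modulo 3, so
   the expression of [M_1] lifts to one of [G] over the reflexive path. *)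

(** * Minima, isomorphisms and induced embeddings *)

Lemma pair_ext (A B : Type) (x y : A * B) : x.1 = y.1 -> x.2 = y.2 -> x = y.
Proof. by case: x y => [a b] [c d] /= -> ->. Qed.

(** [W] is an arbitrary proposition, so excluded middle drives the descent to a minimum. *)
Lemma least_at_most_intro (W : nat -> Prop) m n :
  W m -> m <= n -> least_at_most W n.
Proof.
elim/ltn_ind: m => m IH Wm le_mn.
case: (classic (exists2 m', W m' & m' < m)) => [[m' Wm' lt_m'm]|no_less].
  by apply: (IH m') => //; apply: leq_trans le_mn; apply: ltnW.
exists m => //; split=> // m' Wm'; rewrite leqNgt; apply/negP => lt_m'm.
by apply: no_less; exists m'.
Qed.

Lemma iso_refl (G : lgraph) : iso G G.
Proof. by exists id => //; exists id. Qed.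

Lemma embedding_iso_induced (G H : sgraph) (f : G -> H) :
  injective f -> (forall x y, edge (f x) (f y) = edge x y) ->
  iso_induced_subgraph G H.
Proof.
move=> f_inj f_edge; exists [set f x | x in G].
have fP x : f x \in [set f x | x in G] by apply: imset_f.
exists (fun x => Sub (f x) (fP x) : induced [set f x | x in G]) => //.
apply: inj_card_bij => [x y /(congr1 val) /f_inj //|].
by rewrite card_sig (eq_card (B := [set f x | x in G])) // card_imset.
Qed.

(** * Connected sets of nodes in a tree *)

Section Trees.
Variable T : sgraph.
Implicit Types (R : {set T}) (s t : T).

Definition within R : rel T := fun x y => [&& edge x y, x \in R & y \in R].

Definition connected_in R : Prop :=
  {in R &, forall x y, connect (within R) x y}.

Lemma walk_of_induced R (x : induced R) p :
  path (@edge (induced R)) x p ->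
  path (@edge T) (val x) (map val p) /\ last (val x) (map val p) = val (last x p).
Proof. by rewrite path_map last_map. Qed.

Lemma path_within R x p :
  path (within R) x p -> path (@edge T) x p /\ {subset p <= R}.
Proof.
elim: p x => [|y p IH] x //= /andP[/and3P[exy xR yR] /IH[-> sub]].
split; first by rewrite exy.
by move=> z; rewrite inE => /predU1P[->//|/sub].
Qed.

(* Otherwise the path up to its first vertex in [R] closes, inside [R] and
   through [s], into a cycle. *)
Lemma acyclic_attachment R s t p :
  acyclic T -> connected_in R -> s \in R -> t \notin R -> edge s t ->
  path (@edge T) t p -> last t p \in R -> s \in p.
Proof.
move=> T_acyc R_conn sR tR est tp.
case: (shortenP tp) => p' tp' uniq_p' sub_p' lastR.
apply: sub_p'.
have hasR : has (mem R) p'.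
  case: p' lastR {tp' uniq_p'} => [|y p']; first by rewrite /= (negbTE tR).
  by move=> lR; apply/hasP; exists (last y p') => //; apply: mem_last.
case: (split_find hasR) tp' uniq_p' => y p1 p2 /= yR nhas tp' uniq_p'.
rewrite mem_cat mem_rcons inE; case: (s =P y) => //= s_ne_y.
case/connectP: (R_conn _ _ yR sR) => q0 yq0.
case: (shortenP yq0) => q yq uniq_q _ s_last.
have [{}yq qR] := path_within yq.
exfalso; apply: (T_acyc (t :: p1 ++ y :: q)).
  (* [q] is nonempty because [s] differs from [y], so the cycle has at least three vertices. *)
  by case: q s_last {yq uniq_q qR} => [/s_ne_y//|z q] _; rewrite /= size_cat /= !addnS.
move: tp'; rewrite cat_path => /andP[+ _].
rewrite rcons_path => /andP[tp1 p1y].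
rewrite /ucycle /= rcons_cat /= cat_path tp1 /= p1y rcons_path yq -s_last est /=.
move: uniq_p'; rewrite mem_cat mem_rcons inE !negb_or => /andP[/andP[/andP[t_y t_p1] _]].
rewrite cat_uniq rcons_uniq => /andP[/andP[y_p1 uniq_p1] _].
have disj : ~~ has (mem p1) (y :: q).
  rewrite /= negb_or y_p1; apply/hasPn => z zq; apply/negP => zp1.
  by move/hasPn: nhas => /(_ z zp1); rewrite /= qR.
rewrite mem_cat inE !negb_or t_p1 t_y cat_uniq uniq_p1 disj uniq_q !andbT /=.
by apply: contra tR => /qR.
Qed.

Lemma connected_in_attach R s t :
  connected_in R -> s \in R -> edge s t -> connected_in (t |: R).
Proof.
move=> R_conn sR est.
have sub : subrel (connect (within R)) (connect (within (t |: R))).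
  apply: connect_sub => x y /and3P[exy xR yR]; apply: connect1.
  by rewrite /within exy !inE xR yR !orbT.
have st : within (t |: R) s t by rewrite /within est !inE eqxx sR orbT.
have ts : within (t |: R) t s by rewrite /within edge_sym est !inE eqxx sR orbT.
have from_s x : x \in t |: R -> connect (within (t |: R)) s x.
  by case/setU1P => [->|xR]; [apply: connect1 | apply: sub; apply: R_conn].
have to_s x : x \in t |: R -> connect (within (t |: R)) x s.
  by case/setU1P => [->|xR]; [apply: connect1 | apply: sub; apply: R_conn].
by move=> x y /to_s xs /from_s; apply: connect_trans.
Qed.

Lemma boundary_edge R x y :
  connect (@edge T) x y -> x \in R -> y \notin R ->
  exists s t, [/\ s \in R, t \notin R & edge s t].
Proof.
case/connectP => p; elim: p x => [|z p IH] x /= => [_ -> -> //|].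
case/andP=> exz zp y_last xR yR; case: (boolP (z \in R)) => zR; last by exists x, z.
exact: IH zp y_last zR yR.
Qed.

(** An edge leaves every proper subset containing [t0], by connectedness, so the tree is exhausted
    one node at a time; the induction is on the size of the complement. *)
Lemma tree_growth (Q : {set T} -> Prop) (t0 : T) :
  connected T -> Q [set t0] ->
  (forall R s t, connected_in R -> s \in R -> t \notin R -> edge s t ->
     Q R -> Q (t |: R)) ->
  Q setT.
Proof.
move=> T_conn Q0 Qstep.
suff grow n R : #|~: R| = n -> t0 \in R -> connected_in R -> Q R -> Q setT.
  apply: grow (erefl _) _ _ Q0; rewrite ?set11 // => x y /set1P-> /set1P->.
  exact: connect0.
elim: n R => [|n IH] R cardR t0R R_conn QR.
  by rewrite -[setT](_ : R = _) //; apply: setC_inj; rewrite (cards0_eq cardR) setCT.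
have [y] : exists y, y \in ~: R by apply/set0Pn; rewrite -card_gt0 cardR.
rewrite inE => yR; have [s [t [sR tR est]]] := boundary_edge (T_conn t0 y) t0R yR.
apply: (IH (t |: R)); last exact: Qstep est QR.
- apply/eqP; rewrite -(eqn_add2l #|t |: R|) cardsC -(cardsC R) cardR.
  by rewrite cardsU1 tR add1n addSnnS.
- by rewrite inE t0R orbT.
- exact: connected_in_attach R_conn sR est.
Qed.

End Trees.

(** * Elimination order of a tree decomposition *)

Section EliminationOrder.
Variables (M T : sgraph) (bag : T -> {set M}).
Hypothesis bag_dec : tree_decomposition bag.

(** The nodes whose bags contain [x] are connected, so some walk from [t] to [t'] stays among them;
    to enter [R] it must pass through [s]. *)
Lemma bag_separation (R : {set T}) s t t' x :
  connected_in R -> s \in R -> t \notin R -> edge s t -> t' \in R ->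
  x \in bag t -> x \in bag t' -> x \in bag s.
Proof.
move=> R_conn sR tR est t'R xt xt'.
have [[_ _ T_acyc] _ _ bag_conn] := bag_dec.
have tP : t \in [set t | x \in bag t] by rewrite inE.
have t'P : t' \in [set t | x \in bag t] by rewrite inE.
case/connectP: (bag_conn x (Sub t tP) (Sub t' t'P)) => p tp lastp.
have [tp' lastp'] := walk_of_induced tp; move: lastp'; rewrite -lastp /= => lastp'.
have /mapP[u _ ->] : s \in map val p.
  by apply: (acyclic_attachment T_acyc R_conn sR tR est tp'); rewrite lastp'.
by have := valP u; rewrite inE.
Qed.

(* Ranks the vertices by the time when a growing subtree first meets them; the
   witness is the node at which the growth meets [w]. *)
Lemma elimination_rank :
  exists2 r : M -> nat, injective r &
    forall w, exists2 t, w \in bag t &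
      forall t' u, u \in bag t' -> w \in bag t' -> r u < r w -> u \in bag t.
Proof.
have [[T_nonempty T_conn _] bag_cover _ _] := bag_dec.
have [t0 _] := card_gt0P T_nonempty.
pose met (R : {set T}) := \bigcup_(t in R) bag t.
pose Q R := exists2 r : M -> nat, {in met R &, injective r} &
  {in met R, forall w, exists2 t, t \in R & w \in bag t /\
    forall t' u, t' \in R -> u \in bag t' -> w \in bag t' -> r u < r w -> u \in bag t}.
suff [r r_inj r_top] : Q setT.
  have metT w : w \in met setT by have [t wt] := bag_cover w; apply/bigcupP; exists t.
  exists r => [x y|w]; first exact: r_inj.
  have [t _ [wt top]] := r_top w (metT w); exists t => // t' u; exact: top.
apply: (tree_growth (t0 := t0) T_conn).
  exists (fun x => enum_rank x : nat) => [x y _ _ /val_inj/enum_rank_inj//|w].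
  case/bigcupP => t /set1P -> wt; exists t0; rewrite ?set11 //; split=> // t' u.
  by move/set1P => ->.
move=> R s t R_conn sR tR est [r r_inj r_top].
pose N := (\max_x r x).+1.
pose r' x := if x \in met R then r x else N + enum_rank x.
have lt_N x : r x < N by rewrite ltnS (leq_bigmax x).
have r'_old x y : r' x < r' y -> y \in met R -> x \in met R.
  rewrite /r' => + yR; rewrite yR; case: ifP => //.
  by move=> _ /ltn_trans/(_ (lt_N y)); rewrite ltnNge leq_addr.
have old_s x : x \in bag t -> x \in met R -> x \in bag s.
  by move=> xt /bigcupP[t' t'R xt']; apply: (bag_separation R_conn sR tR est t'R xt xt').
have metU x : x \in met (t |: R) = (x \in bag t) || (x \in met R).
  by rewrite /met bigcup_setU big_set1 inE.
exists r' => [x y _ _|w].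
  rewrite /r'; case: ifP => xR; case: ifP => yR.
  - exact: r_inj.
  - by move=> rx; have := lt_N x; rewrite rx ltnNge leq_addr.
  - by move=> ry; have := lt_N y; rewrite -ry ltnNge leq_addr.
  - by move/addnI/val_inj/enum_rank_inj.
(* An old [w] keeps its node: if [t] contains [u] and [w], both old, then so does [s]. A new [w]
   occurs in no bag of [R], so [t] is its node. *)
rewrite metU; case: (boolP (w \in met R)) => wR; rewrite ?orbT ?orbF => w_met.
  have [t1 t1R [wt1 top]] := r_top w wR; exists t1; first by rewrite inE t1R orbT.
  split=> // t' u t'_in ut' wt' lt_uw; have uR := r'_old _ _ lt_uw wR.
  move: lt_uw; rewrite /r' uR wR.
  case/setU1P: t'_in ut' wt' => [->|t'R] ut' wt' lt_uw.
    by apply: (top s) => //; apply: old_s.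
  exact: (top t').
exists t; rewrite ?setU11 //; split=> // t' u /setU1P[->//|t'R] _ wt'.
by case/negP: wR; apply/bigcupP; exists t'.
Qed.

End EliminationOrder.

(** * Clique-width expressions with prescribed vertices, edges and labels, and their lifting over
    [H] *)

Section Realizable.
Variables V L : finType.
Implicit Types (E : rel V) (D : {set V}) (lab : V -> L).

(* Expressions have nonempty values, whence the special case of [set0]. *)
Definition realizable E D lab : Prop :=
  D = set0 \/ exists (e : cw_expr #|L|) (f : cw_value e -> V),
    [/\ injective f, forall x, f x \in D, forall y, y \in D -> exists x, y = f x,
        forall x y, edge x y = E (f x) (f y)
      & forall x, label x = enum_rank (lab (f x))].

Lemma eq_realizable E E' D lab lab' :
  {in D &, E =2 E'} -> {in D, lab =1 lab'} ->
  realizable E D lab -> realizable E' D lab'.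
Proof.
move=> eqE eql [->|[e [f [f_inj fD Df edgef labf]]]]; [by left | right; exists e, f].
by split=> // [x y|x]; rewrite ?edgef ?labf ?eqE ?eql.
Qed.

Lemma realizable_union E D1 D2 lab :
  [disjoint D1 & D2] ->
  (forall x y, x \in D1 -> y \in D2 -> E x y = false /\ E y x = false) ->
  realizable E D1 lab -> realizable E D2 lab -> realizable E (D1 :|: D2) lab.
Proof.
move=> disj noE [->|[e1 [f1 [f1_inj fD1 Df1 edge1 lab1]]]]; first by rewrite set0U.
case=> [->|[e2 [f2 [f2_inj fD2 Df2 edge2 lab2]]]]; first by rewrite setU0; right; exists e1, f1.
have neq x y : f1 x <> f2 y.
  by move=> eqf; move/pred0P: disj => /(_ (f1 x)); rewrite /= fD1 eqf fD2.
right; exists (CUnion e1 e2), (fun x => match x with inl x => f1 x | inr x => f2 x end).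
split.
- move=> [x|x] [y|y] //= => [/f1_inj->//|/neq[]|/esym/neq[]|/f2_inj->//].
- by case=> x; rewrite inE ?fD1 ?fD2 ?orbT.
- move=> y /setUP[/Df1[x ->]|/Df2[x ->]]; [by exists (inl x) | by exists (inr x)].
- move=> [x|x] [y|y] //=.
    by have [] := noE _ _ (fD1 x) (fD2 y).
  by have [] := noE _ _ (fD1 y) (fD2 x).
- by case=> x /=; rewrite ?lab1 ?lab2.
Qed.

Lemma realizable_edgeless D lab : realizable (fun _ _ => false) D lab.
Proof.
have single x : realizable (fun _ _ => false) [set x] lab.
  right; exists (CVertex (enum_rank (lab x))), (fun=> x).
  split=> //= [[] []//|_|y /set1P->]; [exact: set11 | by exists tt].
elim/ltn_ind: {D}_.+1 {-2}D (ltnSn #|D|) => n IH D cardD.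
have [->|[x xD]] := set_0Vmem D; first by left.
rewrite -(setD1K xD); apply: realizable_union (single x) _ => //.
  by rewrite disjoints1 !inE eqxx.
by apply: IH (ltnSn _); rewrite (leq_trans _ cardD) // ltnS [X in _ < X](cardsD1 x) xD.
Qed.

Lemma realizable_join1 E D lab i j : i != j -> realizable E D lab ->
  realizable (fun x y => E x y || ((lab x == i) && (lab y == j) ||
                                   (lab y == i) && (lab x == j))) D lab.
Proof.
rewrite -(inj_eq enum_rank_inj) => ij [->|[e [f [f_inj fD Df edgef labf]]]]; first by left.
right; exists (CJoin ij e), f; split=> // x y /=.
by rewrite /added_edge /cw_rel edgef !labf !(inj_eq enum_rank_inj).
Qed.

(** The pairs of labels related by [R] are joined one at a time; irreflexivity supplies the distinct
    labels that a single join demands. *)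
Lemma realizable_join E D lab (R : rel L) : irreflexive R -> realizable E D lab ->
  realizable (fun x y => E x y || (R (lab x) (lab y) || R (lab y) (lab x))) D lab.
Proof.
move=> R_irr realE.
pose hit x y (p : L * L) := (lab x == p.1) && (lab y == p.2) ||
                            (lab y == p.1) && (lab x == p.2).
suff joins ps : {in ps, forall p, p.1 != p.2} ->
    realizable (fun x y => E x y || has (hit x y) ps) D lab.
  have neqR : {in [seq p <- enum {: L * L} | R p.1 p.2], forall p, p.1 != p.2}.
    move=> [a b]; rewrite mem_filter => /andP[/= Rab _].
    by apply: contraTneq Rab => ->; rewrite R_irr.
  apply: eq_realizable (joins _ neqR) => // x y _ _; congr (_ || _).
  apply/hasP/orP => [[[a b]]|].
    rewrite mem_filter => /andP[/= Rab _] /orP[] /andP[/eqP-> /eqP->]; by [left|right].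
  by case=> Rxy; [exists (lab x, lab y) | exists (lab y, lab x)];
    [rewrite mem_filter mem_enum /= Rxy | rewrite /hit !eqxx ?orbT
    |rewrite mem_filter mem_enum /= Rxy | rewrite /hit !eqxx ?orbT].
elim: ps => [|p ps IH] neq.
  by apply: eq_realizable realE => // x y _ _ /=; rewrite orbF.
have := realizable_join1 (neq p (mem_head _ _)) (IH _).
move=> step; apply: eq_realizable (step _) => // [x y _ _ /=|q qps].
  by rewrite -orbA; congr (_ || _); rewrite orbC.
by apply: neq; rewrite inE qps orbT.
Qed.

Lemma realizable_relabel1 E D lab i j : i != j -> realizable E D lab ->
  realizable E D (fun x => if lab x == i then j else lab x).
Proof.
rewrite -(inj_eq enum_rank_inj) => ij [->|[e [f [f_inj fD Df edgef labf]]]]; first by left.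
right; exists (CRelabel ij e), f; split=> // x /=.
by rewrite labf (inj_eq enum_rank_inj); case: ifP.
Qed.

(* Idempotence lets the labels be replaced one after the other. *)
Lemma realizable_relabel E D lab (phi : L -> L) :
  (forall a, phi (phi a) = phi a) -> realizable E D lab ->
  realizable E D (fun x => phi (lab x)).
Proof.
move=> phi_id realE.
suff relabels (s : seq L) : realizable E D (fun x => if lab x \in s then phi (lab x) else lab x).
  by apply: eq_realizable (relabels (enum L)) => // x _; rewrite mem_enum.
elim: s => [|i s IH]; first exact: eq_realizable realE.
case: (eqVneq i (phi i)) => [i_fix|i_move].
  by apply: eq_realizable IH => // x _; rewrite inE; case: eqP => // ->; case: ifP.
apply: eq_realizable (realizable_relabel1 i_move IH) => // x _; rewrite inE.
case: (boolP (lab x \in s)) => _; rewrite ?orbT ?orbF.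
  by case: eqP => // eqi; move: i_move; rewrite -eqi phi_id eqxx.
by case: eqP => // ->.
Qed.

End Realizable.

(* The copies [(p, x)] of one vertex [x] stay pairwise nonadjacent, unlike in the
   strong product. *)
Lemma hcw_of_cw (H : lgraph) l (e : cw_expr l) (D : {set H * cw_value e}) :
  D != set0 -> exists (e' : hcw_expr H l) (f : hcw_value e' -> H * cw_value e),
    [/\ injective f, forall x, f x \in D, forall y, y \in D -> exists x, y = f x,
        forall x y, edge x y = edge (f x).1 (f y).1 && edge (f x).2 (f y).2
      & forall x, label x = (label (f x).2, (f x).1)].
Proof.
elim: e D => [i|e1 IH1 e2 IH2|i j ij e IH|i j ij e IH] D D_n0.
- elim/ltn_ind: {D}_.+1 {-2}D (ltnSn #|D|) D_n0 => n IH D cardD /set0Pn[[p []] pD].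
  have [D'0|D'_n0] := eqVneq (D :\ (p, tt)) set0.
    exists (HVertex i p), (fun=> (p, tt)); split=> //= [[] []//|y yD|_ _]; last by rewrite andbF.
    exists tt; apply/eqP; apply: contraTT yD => y_p; apply/negP => yD.
    by move/setP/(_ y): D'0; rewrite !inE y_p yD.
  have [|e' [f [f_inj fD Df edgef labf]]] := IH _ _ _ (ltnSn #|D :\ (p, tt)|) D'_n0.
    by rewrite (leq_trans _ cardD) // ltnS [X in _ < X](cardsD1 (p, tt)) pD.
  have fp x : f x <> (p, tt) by move=> fx; move: (fD x); rewrite fx !inE eqxx.
  exists (HUnion (HVertex i p) e'), (fun x => if x is inr x then f x else (p, tt)).
  split.
  - by case=> [[]|x] [[]|y] //= => [/esym/fp[]|/fp[]|/f_inj->//].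
  - by case=> [_|x] //; have := fD x; rewrite inE => /andP[].
  - move=> y yD; have [->|y_p] := eqVneq y (p, tt); first by exists (inl tt).
    by have [|x ->] := Df y; [rewrite !inE y_p | exists (inr x)].
  - by move=> [x|x] [y|y] //=; rewrite ?andbF ?edgef.
  - by case=> [x|x] //=; rewrite labf.
- pose D1 : {set H * cw_value e1} := [set x | (x.1, inl x.2) \in D].
  pose D2 : {set H * cw_value e2} := [set x | (x.1, inr x.2) \in D].
  pose g1 (x : H * cw_value e1) : H * cw_value (CUnion e1 e2) := (x.1, inl x.2).
  pose g2 (x : H * cw_value e2) : H * cw_value (CUnion e1 e2) := (x.1, inr x.2).
  (* No expression has an empty value, so a side that [D] misses is left out. *)
  have [D10|D1_n0] := eqVneq D1 set0.
    have [D20|D2_n0] := eqVneq D2 set0.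
      case/set0Pn: D_n0 => [[p [x|x]] xD].
        by move/setP/(_ (p, x)): D10; rewrite !inE xD.
      by move/setP/(_ (p, x)): D20; rewrite !inE xD.
    have [e' [f [f_inj fD Df edgef labf]]] := IH2 _ D2_n0.
    exists e', (g2 \o f); split=> //=.
    + by move=> x y [eq1 eq2]; exact/f_inj/pair_ext.
    + by move=> x; have := fD x; rewrite inE.
    + move=> [p [x|x]] xD; first by move/setP/(_ (p, x)): D10; rewrite !inE xD.
      by have [|y eqy] := Df (p, x); [rewrite inE | exists y; rewrite /g2 -eqy].
  have [e1' [f1 [f1_inj fD1 Df1 edgef1 labf1]]] := IH1 _ D1_n0.
  have [D20|D2_n0] := eqVneq D2 set0.
    exists e1', (g1 \o f1); split=> //=.
    + by move=> x y [eq1 eq2]; exact/f1_inj/pair_ext.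
    + by move=> x; have := fD1 x; rewrite inE.
    + move=> [p [x|x]] xD; last by move/setP/(_ (p, x)): D20; rewrite !inE xD.
      by have [|y eqy] := Df1 (p, x); [rewrite inE | exists y; rewrite /g1 -eqy].
  have [e2' [f2 [f2_inj fD2 Df2 edgef2 labf2]]] := IH2 _ D2_n0.
  exists (HUnion e1' e2'), (fun x => match x with inl x => g1 (f1 x) | inr x => g2 (f2 x) end).
  split.
  + move=> [x|x] [y|y] //= [eq1 eq2]; congr (_ _).
      by exact/f1_inj/pair_ext.
    by exact/f2_inj/pair_ext.
  + by case=> x; [have := fD1 x | have := fD2 x]; rewrite inE.
  + move=> [p [x|x]] xD.
      by have [|y eqy] := Df1 (p, x); [rewrite inE | exists (inl y); rewrite /g1 -eqy].
    by have [|y eqy] := Df2 (p, x); [rewrite inE | exists (inr y); rewrite /g2 -eqy].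
  + by move=> [x|x] [y|y] //=; rewrite ?andbF ?edgef1 ?edgef2.
  + by case=> x /=; rewrite ?labf1 ?labf2.
- have [e' [f [f_inj fD Df edgef labf]]] := IH D D_n0.
  exists (HJoin ij e'), f; split=> // x y /=.
  rewrite /added_edge /hcw_rel /cw_rel edgef !labf /= (edge_sym (f y).1).
  by case: (edge (f x).1 (f y).1); rewrite ?andbT ?andbF.
- have [e' [f [f_inj fD Df edgef labf]]] := IH D D_n0.
  exists (HRelabel ij e'), f; split=> // x /=.
  by rewrite labf /=; case: ifP.
Qed.

(** * Colouring along the elimination order *)

Section GreedyColouring.
Variables (M : finType) (k : nat) (r : M -> nat) (B : M -> {set M}).
Hypothesis r_inj : injective r.
Hypothesis B_lt : forall u v, u \in B v -> r u < r v.
Hypothesis B_clique :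
  forall u u' v, u \in B v -> u' \in B v -> r u < r u' -> u \in B u'.
Hypothesis B_small : forall v, #|B v| <= k.

(** Vertices are coloured in increasing rank: at most [k] of the [k + 1] colours are taken in [B v].
    Two vertices of [v |: B v] differ in colour because the later one has the earlier one in its own
    [B]. *)
Lemma greedy_colouring : exists col : M -> 'I_k.+1,
  forall v, {in v |: B v &, injective col}.
Proof.
have [col col_neq] : exists col : M -> 'I_k.+1, forall v u, u \in B v -> col u != col v.
  suff /(_ (\max_v r v).+1)[col col_neq] : forall i, exists col : M -> 'I_k.+1,
      forall v u, r v < i -> u \in B v -> col u != col v.
    by exists col => v u; apply: col_neq; rewrite ltnS (leq_bigmax v).
  elim=> [|i [col col_neq]]; first by exists (fun=> ord0).
  case: (pickP (fun v => r v == i)) => [v0 /eqP r_v0|no_v0]; last first.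
    by exists col => v u; rewrite ltnS leq_eqVlt no_v0 /=; apply: col_neq.
  have [c] : exists c, c \in ~: (col @: B v0).
    apply/set0Pn; rewrite -card_gt0 -(ltn_add2l #|col @: B v0|) cardsC addn0 card_ord.
    by rewrite ltnS (leq_trans (leq_imset_card _ _)).
  rewrite inE => c_new; exists (fun v => if v == v0 then c else col v) => v u.
  have [->|v_v0] := eqVneq v v0 => [_ uv0|].
    have [eq_u|_] := eqVneq u v0; first by have := B_lt uv0; rewrite eq_u ltnn.
    by apply: contraNneq c_new => <-; apply: imset_f.
  rewrite ltnS leq_eqVlt -{1}r_v0 (inj_eq r_inj) (negbTE v_v0) /= => lt_v uv.
  have [eq_u|_] := eqVneq u v0; last exact: col_neq.
  by have := ltn_trans (B_lt uv) lt_v; rewrite eq_u r_v0 ltnn.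
exists col => v u w; wlog lt_uw : u w / r u < r w => [gain|].
  case: (ltngtP (r u) (r w)) => [lt_uw|lt_wu|/r_inj//]; first exact: gain.
  by move=> uK wK /esym eq_col; apply/esym; apply: gain eq_col.
case/setU1P => [eq_u|uv] /setU1P[eq_w|wv] eq_col; first by rewrite eq_u eq_w.
- by have := ltn_trans lt_uw (B_lt wv); rewrite eq_u ltnn.
- by have := col_neq _ _ uv; rewrite eq_col eq_w eqxx.
- by have := col_neq _ _ (B_clique uv wv lt_uw); rewrite eq_col eqxx.
Qed.
End GreedyColouring.

(** * The blow-up and its clique-width *)

Section BlowUp.
Variables (M : finType) (k : nat) (r : M -> nat) (B : M -> {set M}).
Variable col : M -> 'I_k.+1.
Hypothesis r_inj : injective r.
Hypothesis B_lt : forall u v, u \in B v -> r u < r v.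
Hypothesis B_clique :
  forall u u' v, u \in B v -> u' \in B v -> r u < r u' -> u \in B u'.
Hypothesis col_inj : forall v, {in v |: B v &, injective col}.

(* In [(v, (a, S))], [a] is the residue modulo 3 of the position on the path, and
   [(c, b) \in S] asks for an edge to the vertex of [v |: B v] of colour [c] at a
   position of residue [b]. *)
Definition copy := (M * ('I_3 * {set 'I_k.+1 * 'I_3}))%type.

(** Arcs point towards smaller rank, except between copies of one vertex; those must differ in
    residue, as adjacent positions do, which excludes loops. *)
Definition arc : rel copy := fun x y =>
  ((col y.1, y.2.1) \in x.2.2) &&
  ((y.1 \in B x.1) || (y.1 == x.1) && (x.2.1 != y.2.1)).

Definition blowup_edge : rel copy := fun x y => arc x y || arc y x.

Lemma blowup_sym : symmetric blowup_edge.
Proof. by move=> x y; rewrite /blowup_edge orbC. Qed.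

Lemma back_irr v : v \in B v = false.
Proof. by apply/negP => /B_lt; rewrite ltnn. Qed.

Lemma blowup_irr : irreflexive blowup_edge.
Proof. by move=> x; rewrite /blowup_edge /arc back_irr eqxx /= eqxx andbF. Qed.

Definition blowup : sgraph := @SGraph (LGraph blowup_sym) blowup_irr.

(* The vertices of rank at least [i] have been created; a label records the
   requests to vertices which are still to come. *)
Definition pending i (x : copy) : option 'I_3 * {set 'I_k.+1 * 'I_3} :=
  (None, [set q in x.2.2 | q.1 \in col @: [set w in B x.1 | r w < i]]).

(** The elimination tree: such a [u] is the vertex of largest rank in [B v]. *)
Definition parent v : option M := [pick u in B v | B v \subset u |: B u].

Lemma parent_back v u : parent v = Some u -> u \in B v.
Proof. by rewrite /parent; case: pickP => // u' /andP[? _] [<-]. Qed.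

(** As [B v] is a clique, its member of largest rank qualifies as parent. *)
Lemma back_parent v w : w \in B v -> exists2 u, parent v = Some u & w \in u |: B u.
Proof.
move=> wv; rewrite /parent; case: pickP => [u /andP[_ /subsetP sub]|].
  by exists u => //; apply: sub.
case: (arg_maxnP (P := [in B v]) r wv) => u uv u_max /(_ u) /negP[].
rewrite [_ \in _]uv /=; apply/subsetP => w' w'v; rewrite in_setU1.
case: eqP => //= w'_u; apply: (B_clique w'v uv).
by rewrite ltn_neqAle (inj_eq r_inj) (introN eqP w'_u) /=; exact: (u_max w' w'v).
Qed.

Section Stage.
Variables (i : nat) (own : M -> option M).

Definition owned o : {set copy} := [set x | (i <= r x.1) && (own x.1 == o)].

(* [own] names the subtree rooted at a remaining vertex to which a created one
   is attached. *)
Definition stage : Prop :=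
  [/\ forall v u, i <= r v -> own v = Some u -> r u < i,
      forall v w, i <= r v -> w \in B v -> r w < i ->
        exists2 u, own v = Some u & w \in u |: B u,
      forall v w, i <= r v -> i <= r w -> w \in B v -> own v = own w
    & forall o, realizable blowup_edge (owned o) (pending i)].
End Stage.

Section Step.
Variables (i : nat) (own : M -> option M) (v0 : M).
Hypothesis r_v0 : r v0 = i.
Hypothesis stage_i1 : stage i.+1 own.

(** Creating [v0] joins the subtrees attached to it, which then hang together from its parent. *)
Let own' v := if (v == v0) || (own v == Some v0) then parent v0 else own v.

Let new : {set copy} := [set x | x.1 == v0].

(** The owner of [v] is [v0] or has [v0] in its own [B]; the latter would give it rank above [i],
    but owners are not created yet. *)
Let v0_back v : i < r v -> v0 \in B v -> own v = Some v0.
Proof.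
move=> lt_v v0v; have [J1 J2 _ _] := stage_i1.
have [|u own_v] := J2 _ _ lt_v v0v; first by rewrite r_v0.
case/setU1P => [->//|/B_lt]; rewrite r_v0 => lt_u.
by have := J1 _ _ lt_v own_v; rewrite ltnS leqNgt lt_u.
Qed.

Let owner_back v w : i < r v -> own v = Some v0 -> w \in B v -> r w <= i ->
  w \in v0 |: B v0.
Proof.
move=> lt_v own_v wv lt_w; have [_ J2 _ _] := stage_i1.
by have [u + wu] := J2 _ _ lt_v wv lt_w; rewrite own_v => -[->].
Qed.

Let le_i v : (i <= r v) = (v == v0) || (i < r v).
Proof. by rewrite leq_eqVlt -{1}r_v0 (inj_eq r_inj) eq_sym. Qed.

Let no_request v : i < r v -> own v != Some v0 -> v0 \notin B v.
Proof. by move=> lt_v; apply: contraNN => /(v0_back lt_v) ->. Qed.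

(** The subtrees attached to [v0] are united with the edgeless copies of [v0], marked by their
    residues; joins create the edges between the two and among the copies; a relabelling removes the
    marks and the requests to [v0]. *)
Let realizable_merged :
  realizable blowup_edge (owned i.+1 own (Some v0) :|: new) (pending i).
Proof.
have [_ _ _ /(_ (Some v0)) real0] := stage_i1.
pose lab x := if x.1 == v0 then (Some x.2.1, x.2.2) else pending i.+1 x.
have lab_new x : x.1 = v0 -> lab x = (Some x.2.1, x.2.2) by rewrite /lab => ->; rewrite eqxx.
have lab_old x : x.1 != v0 -> lab x = pending i.+1 x by rewrite /lab => /negbTE->.
pose E0 x y := [&& blowup_edge x y, x.1 != v0 & y.1 != v0].
have ownedP x : x \in owned i.+1 own (Some v0) ->
    [/\ i < r x.1, own x.1 = Some v0 & x.1 != v0].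
  rewrite inE => /andP[lt_x /eqP own_x]; split=> //.
  by apply: contraTneq lt_x => ->; rewrite r_v0 ltnn.
have real_union : realizable E0 (owned i.+1 own (Some v0) :|: new) lab.
  apply: realizable_union.
  - apply/pred0P => x /=; apply: contraTF isT => /andP[/ownedP[_ _ /negbTE x_v0]].
    by rewrite inE x_v0.
  - by move=> x y _; rewrite inE /E0 => /eqP ->; rewrite eqxx /= !andbF.
  - apply: eq_realizable real0 => [x y /ownedP[_ _ x_v0] /ownedP[_ _ y_v0]|x].
      by rewrite /E0 x_v0 y_v0 !andbT.
    by case/ownedP=> _ _ /negbTE x_v0; rewrite /lab x_v0.
  - apply: eq_realizable (realizable_edgeless new lab) => // x y.
    by rewrite inE /E0 => /eqP ->; rewrite eqxx /= andbF.
pose R : rel (option 'I_3 * {set 'I_k.+1 * 'I_3}) := fun a b =>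
  if b.1 is Some q then ((col v0, q) \in a.2) && (a.1 != b.1) else false.
have R_irr : irreflexive R by case=> [[q|] S]; rewrite /R //= eqxx andbF.
(* Keeping the colours of [B v0] drops that of [v0], which differs from all of them. *)
pose phi (a : option 'I_3 * {set 'I_k.+1 * 'I_3}) :=
  (None : option 'I_3, [set q in a.2 | q.1 \in col @: B v0]).
have phi_id a : phi (phi a) = phi a.
  by congr (_, _); apply/setP => q; rewrite !inE -andbA andbb.
have arcE : {in owned i.+1 own (Some v0) :|: new &, forall x y,
    arc x y = [&& arc x y, x.1 != v0 & y.1 != v0] || R (lab x) (lab y)}.
  move=> x y x_in y_in; have [y_v0|y_v0] := eqVneq y.1 v0; last first.
    rewrite /R (lab_old _ y_v0) /= orbF andbT.
    have [x_v0|_] := eqVneq x.1 v0; rewrite ?andbT ?andbF //.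
    apply/negP => /andP[_]; rewrite x_v0 (negbTE y_v0) /= orbF => /B_lt.
    move: y_in; rewrite in_setU [X in _ || X]inE (negbTE y_v0) orbF inE => /andP[lt_y _].
    by rewrite r_v0 ltnNge (ltnW lt_y).
  rewrite !andbF orFb /R /lab y_v0 eqxx /arc y_v0.
  have [x_v0|x_v0] := eqVneq x.1 v0; first by rewrite x_v0 back_irr.
  rewrite orbF /= andbT inE /=; congr (_ && _).
  have [lt_x own_x _] : [/\ i < r x.1, own x.1 = Some v0 & x.1 != v0].
    by apply: ownedP; move: x_in; rewrite in_setU [X in _ || X]inE (negbTE x_v0) orbF.
  apply/idP/imsetP => [v0x|[w]]; first by exists v0; rewrite // inE v0x r_v0 ltnS leqnn.
  rewrite inE ltnS => /andP[wx le_w] eq_col.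
  (* [col] is injective on [v0 |: B v0], so a pending request for the colour of [v0] can only mean
     [v0]. *)
  have wK := owner_back lt_x own_x wx le_w.
  by rewrite (col_inj (setU11 _ _) wK eq_col).
have := realizable_relabel phi_id (realizable_join R_irr real_union).
apply: eq_realizable => [x y x_in y_in|x x_in].
  rewrite /E0 /blowup_edge (arcE x y) // (arcE y x) //.
  by case: (x.1 != v0); case: (y.1 != v0); case: (arc x y); case: (arc y x);
    case: (R (lab x) (lab y)); case: (R (lab y) (lab x)).
have [x_v0|x_v0] := eqVneq x.1 v0.
  rewrite lab_new // /phi /pending; congr (_, _); apply/setP => q; rewrite !inE /=.
  rewrite (_ : [set w in B x.1 | r w < i] = B v0) //; apply/setP => w.
  by rewrite x_v0 inE -r_v0; case: (boolP (w \in B v0)) => // /B_lt.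
have [lt_x own_x _] : [/\ i < r x.1, own x.1 = Some v0 & x.1 != v0].
  by apply: ownedP; move: x_in; rewrite in_setU [X in _ || X]inE (negbTE x_v0) orbF.
rewrite lab_old // /phi /pending; congr (_, _); apply/setP => q; rewrite !inE /=.
rewrite -andbA; congr (_ && _); apply/andP/imsetP => [[/imsetP[w]]|[w]].
  rewrite inE ltnS => /andP[wx le_w] -> /imsetP[w' w'v0 eq_col].
  have wK := owner_back lt_x own_x wx le_w.
  have eq_w := col_inj wK (setU1r v0 w'v0) eq_col.
  by exists w => //; rewrite inE wx eq_w -r_v0 B_lt.
rewrite inE => /andP[wx lt_w] ->; have := owner_back lt_x own_x wx (ltnW lt_w).
case/setU1P => [eq_w|wv0]; first by move: lt_w; rewrite eq_w r_v0 ltnn.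
by split; apply: imset_f; rewrite // inE wx ltnS ltnW.
Qed.

(** Only two classes change: that of [Some v0] becomes empty, and that of [parent v0] absorbs it
    together with the new copies. *)
Lemma stage_step : stage i own'.
Proof.
have [J1 J2 J3 J4] := stage_i1.
have parent_neq : parent v0 != Some v0.
  by apply/eqP => /parent_back; rewrite back_irr.
have own'_neq v : own' v != Some v0.
  by rewrite /own'; case: ifP => // /norP[].
split.
- move=> v u; rewrite le_i /own'; have [->|v_v0] /= := eqVneq v v0.
    by move=> _ /parent_back/B_lt; rewrite r_v0.
  move=> lt_v; have [own_v|own_v] := eqVneq (own v) (Some v0).
    by move/parent_back/B_lt; rewrite r_v0.
  move=> own_u; have := J1 _ _ lt_v own_u; rewrite ltnS leq_eqVlt -{1}r_v0 (inj_eq r_inj).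
  by case/predU1P => // eq_u; rewrite own_u eq_u eqxx in own_v.
- move=> v w; rewrite le_i /own'; have [-> _ /back_parent//|v_v0] /= := eqVneq v v0.
  move=> lt_v wv lt_w; have [own_v|own_v] := eqVneq (own v) (Some v0); last exact: J2 (ltnW _).
  case/setU1P: (owner_back lt_v own_v wv (ltnW lt_w)) => [eq_w|]; last exact: back_parent.
  by move: lt_w; rewrite eq_w r_v0 ltnn.
- move=> v w; rewrite !le_i /own'; have [->|v_v0] /= := eqVneq v v0.
    move=> _ + /B_lt; rewrite r_v0; case/predU1P => [->|lt_w]; first by rewrite r_v0 ltnn.
    by move=> lt_w'; have := ltn_trans lt_w lt_w'; rewrite ltnn.
  move=> lt_v; have [-> _ /(v0_back lt_v)->|w_v0 /=] := eqVneq w v0; first by rewrite eqxx.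
  by move=> lt_w wv; rewrite (J3 _ _ lt_v lt_w wv).
- move=> o; have [->|o_v0] := eqVneq o (Some v0).
    by left; apply/setP => x; rewrite !inE (negbTE (own'_neq _)) andbF.
  (* No vertex [x] of another class has [v0] in [B x.1], so its pending requests are the same at [i]
     and [i.+1]. *)
  have real_o : realizable blowup_edge (owned i.+1 own o) (pending i).
    apply: eq_realizable (J4 o) => // x; rewrite inE => /andP[lt_x /eqP own_x].
    rewrite /pending (_ : [set w in B x.1 | r w < i.+1] = [set w in B x.1 | r w < i]) //.
    apply/setP => w; rewrite !inE ltnS.
    rewrite [r w <= i]leq_eqVlt -{1}r_v0 (inj_eq r_inj).
    have [->|//] := eqVneq w v0; have := no_request lt_x; rewrite own_x => /(_ o_v0).
    by move/negbTE->.
  have [o_parent|o_parent] := eqVneq o (parent v0); last first.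
    rewrite (_ : owned i own' o = owned i.+1 own o) //; apply/setP => x; rewrite !inE le_i /own'.
    have [->|x_v0] /= := eqVneq x.1 v0; first by rewrite r_v0 ltnn eq_sym (negbTE o_parent).
    have [->|//] := eqVneq (own x.1) (Some v0); rewrite [Some v0 == o]eq_sym (negbTE o_v0).
    by rewrite [_ == o]eq_sym (negbTE o_parent).
  rewrite (_ : owned i own' o = owned i.+1 own o :|: (owned i.+1 own (Some v0) :|: new)).
    apply: realizable_union real_o realizable_merged.
    + apply/pred0P => x /=; rewrite !inE.
      have [->|_] := eqVneq x.1 v0; first by rewrite r_v0 ltnn.
      by rewrite orbF; have [->|] := eqVneq (own x.1) o; rewrite ?andbF // (negbTE o_v0) !andbF.
    (* An arc between created vertices stays within a class, and created vertices requesting [v0]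
       belong to the class of [v0]. *)
    + move=> x y; rewrite !inE => /andP[lt_x /eqP own_x] y_in.
      suff noarc : ~~ arc x y /\ ~~ arc y x.
        by rewrite /blowup_edge; case: noarc => /negbTE-> /negbTE->.
      have own_xv0 : own x.1 != Some v0 by rewrite own_x.
      have v0x := no_request lt_x own_xv0.
      case/orP: y_in => [/andP[lt_y /eqP own_y]|/eqP y_v0].
        rewrite /arc; split; apply/negP => /andP[_ /orP[back|/andP[/eqP eqv _]]].
        * by move: own_xv0; rewrite (J3 _ _ lt_x lt_y back) own_y eqxx.
        * by move: own_xv0; rewrite -eqv own_y eqxx.
        * by move: own_xv0; rewrite -(J3 _ _ lt_y lt_x back) own_y eqxx.
        * by move: own_xv0; rewrite eqv own_y eqxx.
      have x_v0 : x.1 != v0 by apply: contraTneq lt_x => ->; rewrite r_v0 ltnn.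
      rewrite /arc y_v0 (negbTE v0x) (negbTE x_v0) [v0 == _]eq_sym (negbTE x_v0) !orbF !andbF.
      split=> //; apply/negP => /andP[_ /B_lt].
      by rewrite r_v0 ltnNge (ltnW lt_x).
  apply/setP => x; rewrite !inE le_i /own'; have [x_v0|x_v0] /= := eqVneq x.1 v0.
    by rewrite o_parent eqxx !orbT.
  rewrite orbF; case: (i < r x.1) => //=; have [->|_] := eqVneq (own x.1) (Some v0).
    by rewrite o_parent eqxx orbT.
  by rewrite orbF.
Qed.
End Step.

(** Stages run downwards in rank, from an empty one to stage 0, where no vertex is left to be an
    owner and everything lies in the class of [None]. *)
Lemma blowup_realizable : realizable blowup_edge setT (pending 0).
Proof.
suff from_stage i own : stage i own -> realizable blowup_edge setT (pending 0).
  have late v : (\max_v r v < r v) = false by rewrite ltnNge (leq_bigmax v).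
  apply: (from_stage (\max_v r v).+1 (fun=> None)); split=> [v u|v w|v w|o].
  - by rewrite late.
  - by rewrite late.
  - by rewrite late.
  - by left; apply/setP => x; rewrite !inE late.
elim: i own => [|i IH] own; last first.
  move=> stage_i1; case: (pickP (fun v => r v == i)) => [v0 /eqP r_v0|no_v0].
    exact: IH (stage_step r_v0 stage_i1).
  (* Ranks need not be consecutive: if none equals [i], the stage carries over. *)
  have le_i v : (i <= r v) = (i < r v) by rewrite leq_eqVlt eq_sym no_v0.
  have le_i' v : (r v < i.+1) = (r v < i) by rewrite ltnS leq_eqVlt no_v0.
  have [J1 J2 J3 J4] := stage_i1.
  apply: (IH own); split=> [v u|v w|v w|o].
  - by rewrite le_i -le_i'; apply: J1.
  - by rewrite le_i -le_i'; apply: J2.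
  - by rewrite !le_i; apply: J3.
  - rewrite (_ : owned i own o = owned i.+1 own o); last by apply/setP => x; rewrite !inE le_i.
    apply: eq_realizable (J4 o) => // x _; rewrite /pending.
    rewrite (_ : [set w in B x.1 | r w < i.+1] = [set w in B x.1 | r w < i]) //.
    by apply/setP => w; rewrite !inE le_i'.
move=> [J1 _ _ /(_ None)]; rewrite (_ : owned 0 own None = setT) //.
apply/setP => x; rewrite !inE /=; apply/eqP.
by case own_x: (own x.1) => [u|//]; have := J1 _ _ (leq0n _) own_x.
Qed.

(** Four markers, [None] and the three residues, times the subsets of [3 * (k + 1)] pairs. *)
Lemma card_labels : #|{: option 'I_3 * {set 'I_k.+1 * 'I_3}}| = 4 * 8 ^ (k + 1).
Proof.
by rewrite card_prod card_option card_ord -cardsT -powersetT card_powerset cardsT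
  card_prod !card_ord mulnC expnM addn1 -[8]/(2 ^ 3) -!expnM mulnC [3 * _]mulnC.
Qed.

Lemma blowup_cw_expr : M -> exists e : cw_expr (4 * 8 ^ (k + 1)), iso blowup (cw_value e).
Proof.
move=> v; rewrite -card_labels; case: blowup_realizable => [/setP/(_ (v, (ord0, set0)))|].
  by rewrite !inE.
case=> e [f [f_inj _ f_onto f_edge _]]; exists e.
have f_bij : bijective f.
  apply: inj_card_bij => //; rewrite -(card_codom f_inj).
  by apply/subset_leq_card/subsetP => y _; have [x ->] := f_onto y (in_setT y); apply: codom_f.
case: (f_bij) => g fK gK; exists g; first by exists f.
by move=> x y; rewrite f_edge !gK.
Qed.

End BlowUp.

(** * Elimination structure from small bags, and the tree-width of the blow-up *)

Lemma small_bags (M : sgraph) k : tree_width_at_most M k ->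
  exists (T : sgraph) (bag : T -> {set M}),
    tree_decomposition bag /\ forall t, #|bag t| <= k.+1.
Proof.
case=> w [[T [bag [bag_dec width_w]]] _] le_wk; exists T, bag; split=> // t.
have := leq_bigmax (F := fun t => #|bag t|) t; move: width_w; rewrite /decomposition_width.
case: (\max_t _) => [_|m /= ->] le_t; first exact: leq_trans le_t _.
exact: leq_trans le_t _.
Qed.

(** One bag contains [v] and all of [B v], the earlier vertices sharing a bag with [v]; this makes
    [B v] a clique and leaves it at most [k] vertices. *)
Lemma elimination_structure (M T : sgraph) (bag : T -> {set M}) k :
  tree_decomposition bag -> (forall t, #|bag t| <= k.+1) ->
  exists (r : M -> nat) (B : M -> {set M}) (col : M -> 'I_k.+1),
    [/\ injective r,
        forall u v, u \in B v -> r u < r v /\ exists2 t, u \in bag t & v \in bag t,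
        forall t u v, u \in bag t -> v \in bag t -> r u < r v -> u \in B v,
        forall u u' v, u \in B v -> u' \in B v -> r u < r u' -> u \in B u'
      & forall v, {in v |: B v &, injective col}].
Proof.
move=> bag_dec bag_small; have [r r_inj r_top] := elimination_rank bag_dec.
pose B v := [set u | (r u < r v) && [exists t, (u \in bag t) && (v \in bag t)]].
have B_in t u v : u \in bag t -> v \in bag t -> r u < r v -> u \in B v.
  by move=> ut vt lt_uv; rewrite inE lt_uv; apply/existsP; exists t; rewrite ut.
have B_out u v : u \in B v -> r u < r v /\ exists2 t, u \in bag t & v \in bag t.
  by rewrite inE => /andP[-> /existsP[t /andP[ut vt]]]; split=> //; exists t.
have B_top v : exists2 t, v \in bag t & {subset B v <= bag t}.
  have [t vt top] := r_top v; exists t => // u /B_out[lt_uv [t' ut' vt']].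
  exact: (top t').
have B_clique u u' v : u \in B v -> u' \in B v -> r u < r u' -> u \in B u'.
  by have [t _ sub] := B_top v; move=> /sub ut /sub u't; apply: (B_in t).
have B_lt u v : u \in B v -> r u < r v by case/B_out.
have B_small v : #|B v| <= k.
  have [t vt sub] := B_top v; rewrite -ltnS; apply: leq_trans (bag_small t).
  rewrite (_ : #|B v|.+1 = #|v |: B v|); last by rewrite cardsU1 (back_irr B_lt).
  by apply/subset_leq_card/subsetP => u /setU1P[->//|/sub].
have [col col_inj] := greedy_colouring r_inj B_lt B_clique B_small.
by exists r, B, col.
Qed.

Section BlowUpDecomposition.
Variables (M T : sgraph) (k : nat) (r : M -> nat) (B : M -> {set M}).
Variables (col : M -> 'I_k.+1) (bag : T -> {set M}).
Hypothesis B_lt : forall u v, u \in B v -> r u < r v.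
Hypothesis B_bag : forall u v, u \in B v -> exists2 t, u \in bag t & v \in bag t.
Hypothesis bag_dec : tree_decomposition bag.
Hypothesis bag_small : forall t, #|bag t| <= k.+1.

Lemma blowup_tree_width :
  tree_width_at_most (blowup col B_lt) (3 * (k + 1) * 8 ^ (k + 1)).
Proof.
have [T_tree bag_cover _ bag_conn] := bag_dec.
pose bag' t : {set blowup col B_lt} := setX (bag t) setT.
have bag'E x t : (x \in bag' t) = (x.1 \in bag t) by rewrite !inE andbT.
have card_bag' t : #|bag' t| <= 3 * (k + 1) * 8 ^ (k + 1).
  rewrite cardsX cardsT card_prod -[#|{set _}|]cardsT -powersetT card_powerset cardsT.
  rewrite card_prod !card_ord [k.+1 * 3]mulnC expnM addn1 mulnA leq_mul2r.
  by rewrite [3 * _]mulnC leq_mul2r bag_small !orbT.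
apply: (least_at_most_intro (m := decomposition_width bag')).
  exists T, bag'; split=> //; split=> // [x|x y exy|x].
  - by have [t xt] := bag_cover x.1; exists t; rewrite bag'E.
  - suff [t xt yt] : exists2 t, x.1 \in bag t & y.1 \in bag t.
      by exists t; rewrite bag'E.
    have same u v : v \in B u \/ v = u -> exists2 t, u \in bag t & v \in bag t.
      by case=> [/B_bag[t vt ut]|->]; [exists t | have [t ut] := bag_cover u; exists t].
    case/orP: exy => /andP[_ /orP back].
      by apply: same; case: back => [->|/andP[/eqP]]; [left | right].
    have [|t yt xt] := same y.1 x.1; last by exists t.
    by case: back => [->|/andP[/eqP]]; [left | right].
  - rewrite (_ : [set t | x \in bag' t] = [set t | x.1 \in bag t]) //.
    by apply/setP => t; rewrite !inE andbT.
(* The bound holds already for the bag sizes, before one is subtracted. *)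
by rewrite /decomposition_width (leq_trans (leq_pred _)) //; apply/bigmax_leqP.
Qed.
End BlowUpDecomposition.

(** * Embedding into the product with the blow-up *)

Lemma eq_of_modn3 m d : d < 3 -> m = m + d %[mod 3] -> d = 0.
Proof.
move=> lt_d3 /eqP; rewrite -{1}[m]addn0 eqn_modDl mod0n modn_small //.
by move/eqP.
Qed.

(** Both [b] and [b'] lie within 1 of [a], so they differ by at most 2. *)
Lemma eq_of_near_modn3 a b b' :
  [|| a == b, a.+1 == b | b.+1 == a] -> [|| a == b', a.+1 == b' | b'.+1 == a] ->
  b = b' %[mod 3] -> b = b'.
Proof.
wlog le_bb' : b b' / b <= b' => [gain|].
  by case/orP: (leq_total b b') => [/gain//|/gain{}gain ab ab' /esym/(gain ab' ab)].
move=> ab ab'; rewrite -(subnKC le_bb') => /eq_of_modn3 ->; first by rewrite addn0.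
have le_ab : a <= b.+1 by case/or3P: ab => /eqP <- //; do !apply: leqW.
have le_b'a : b' <= a.+1 by case/or3P: ab' => /eqP <- //; do !apply: leqW.
by rewrite ltn_subLR // addn3 ltnS (leq_trans le_b'a).
Qed.

Section Embedding.
Variables (G P M : sgraph) (k : nat) (r : M -> nat) (B : M -> {set M}).
Variables (col : M -> 'I_k.+1) (n : nat) (pos : P -> path_graph n.+1).
Variable f : G -> strong_product P M.
Hypothesis r_inj : injective r.
Hypothesis B_lt : forall u v, u \in B v -> r u < r v.
Hypothesis B_edge : forall u v, edge u v -> r u < r v -> u \in B v.
Hypothesis col_inj : forall v, {in v |: B v &, injective col}.
Hypothesis pos_inj : injective pos.
Hypothesis pos_edge : forall p q, edge (pos p) (pos q) = edge p q.
Hypothesis f_inj : injective f.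
Hypothesis f_edge : forall x y, edge x y -> edge (f x) (f y).

Notation near := (@loops_edge P).

Definition residue (p : P) : 'I_3 := Ordinal (ltn_pmod (pos p) (isT : 0 < 3)).

Lemma near_residue p q q' : near p q -> near p q' -> residue q = residue q' -> q = q'.
Proof.
have nearE q1 : near p q1 ->
    [|| pos p == pos q1 :> nat, (pos p).+1 == pos q1 | (pos q1).+1 == pos p].
  rewrite /loops_edge -pos_edge /= /path_edge => /orP[/eqP->|->]; last by rewrite orbT.
  by rewrite eqxx.
move=> /nearE pq /nearE pq' /(congr1 val) /= eq_mod.
exact/pos_inj/val_inj/(eq_of_near_modn3 pq pq' eq_mod).
Qed.

Definition requests (x : G) : {set 'I_k.+1 * 'I_3} :=
  [set q | [exists y, [&& edge x y, (f y).2 \in (f x).2 |: B (f x).2,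
                          col (f y).2 == q.1 & residue (f y).1 == q.2]]].

Definition copy_of (x : G) : copy M k := ((f x).2, (residue (f x).1, requests x)).

Lemma near_of_edge x y : edge x y -> near (f x).1 (f y).1.
Proof.
move/f_edge => /or3P[/andP[exy _]|/andP[exy _]|/andP[exy _]]; rewrite /loops_edge exy ?orbT //.
Qed.

(** The request comes from a neighbour [z] of [x]; its colour fixes the component in [M] and its
    residue the position, so [z] is [y]. *)
Lemma edge_of_arc x y :
  near (f x).1 (f y).1 -> arc B col (copy_of x) (copy_of y) -> edge x y.
Proof.
move=> near_xy /andP[/=]; rewrite inE /= => /existsP[z /and4P[exz zK /eqP eq_col /eqP eq_res]].
move=> y_back.
have yK : (f y).2 \in (f x).2 |: B (f x).2.
  by rewrite in_setU1; case/orP: y_back => [->|/andP[-> _]]; rewrite ?orbT.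
have eq2 := col_inj zK yK eq_col.
have eq1 := near_residue (near_of_edge exz) near_xy eq_res.
by have /f_inj <- : f z = f y by apply: pair_ext.
Qed.

(** This form, with loops on the path, serves both the strong product and the reflexive path. Of two
    adjacent vertices with distinct components in [M], the one of larger rank requests the other. *)
Lemma edge_copy_of x y :
  edge x y = near (f x).1 (f y).1 && blowup_edge B col (copy_of x) (copy_of y).
Proof.
apply/idP/andP => [exy|[near_xy /orP[]]]; last 2 first.
- exact: edge_of_arc.
- by rewrite edge_sym; apply: edge_of_arc; rewrite loops_sym.
split; first exact: near_of_edge.
have eyx : edge y x by rewrite edge_sym.
have request x' y' : edge x' y' -> (f y').2 \in B (f x').2 \/ (f y').2 = (f x').2 ->
    (col (f y').2, residue (f y').1) \in requests x'.
  move=> e' back; rewrite inE; apply/existsP; exists y'; rewrite e' !eqxx !andbT in_setU1.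
  by case: back => ->; rewrite ?eqxx ?orbT.
have [eq2|neq2] := eqVneq (f x).2 (f y).2.
  apply/orP; left; rewrite /arc /= request; [|by []|by right].
  rewrite eq2 eqxx /=; apply/orP; right; apply/eqP => eq_res.
  have eq1 : (f x).1 = (f y).1.
    by apply: near_residue (near_of_edge exy) eq_res; rewrite /loops_edge eqxx.
  move: exy; suff -> : x = y by rewrite edge_irr.
  by exact/f_inj/pair_ext.
have exy2 : edge (f x).2 (f y).2.
  by case/or3P: (f_edge exy) => /andP[] // _ /eqP eq2; rewrite eq2 eqxx in neq2.
case: (ltngtP (r (f x).2) (r (f y).2)) => [lt|lt|/r_inj eq2]; last by rewrite eq2 eqxx in neq2.
  have back := B_edge exy2 lt.
  by apply/orP; right; rewrite /arc /= back request //; left.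
rewrite edge_sym in exy2; have back := B_edge exy2 lt.
by apply/orP; left; rewrite /arc /= back request //; left.
Qed.

Definition embed (x : G) : strong_product P (blowup col B_lt) := ((f x).1, copy_of x).

Lemma embed_inj : injective embed.
Proof.
move=> x y eq_xy; apply/f_inj/pair_ext.
  exact: (congr1 (fun z => z.1) eq_xy).
exact: (congr1 (fun z => z.2.1) eq_xy).
Qed.

(** The strong product also joins equal second components at adjacent positions; no two embedded
    vertices are like that, since their residues would agree. *)
Lemma embed_edge x y : edge (embed x) (embed y) = edge x y.
Proof.
rewrite edge_copy_of /= /strong_edge /= /loops_edge.
have [eq1|neq1] /= := eqVneq (f x).1 (f y).1; first by rewrite eq1 edge_irr /= orbF.
case exy1: (edge _ _) => //=; case: eqP => [eq2|_]; last by rewrite orbF.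
case/eqP: neq1; apply: (near_residue (p := (f x).1)); rewrite /loops_edge ?eqxx ?exy1 ?orbT //.
exact: (congr1 (fun z => z.2.1) eq2).
Qed.

End Embedding.

Theorem corollary5p7 (k : nat) (G P M : sgraph)
  (P_path : is_path P)
  (M_tw : tree_width_at_most M k)
  (G_sub : subgraph G (strong_product P M)) :
  [/\ 4 * 8 ^ (k + 1) = 2 ^ (3 * k + 5),
      exists M1 M2 : sgraph,
        [/\ clique_width_at_most M1 (4 * 8 ^ (k + 1)),
            tree_width_at_most M2 (3 * (k + 1) * 8 ^ (k + 1)),
            iso_induced_subgraph G (strong_product P M1)
          & iso_induced_subgraph G (strong_product P M2)]
    & 0 < #|{: G}| ->
      H_clique_width_at_most is_reflexive_path G (2 ^ (3 * k + 5))].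
Proof.
have bound_eq : 4 * 8 ^ (k + 1) = 2 ^ (3 * k + 5).
  by rewrite -[8]/(2 ^ 3) -expnM -[4]/(2 ^ 2) -expnD mulnDr addnC -addnA.
have [n [pos pos_bij pos_edge]] := P_path.
have [f f_inj f_edge] := G_sub.
have [T [bag [bag_dec bag_small]]] := small_bags M_tw.
have [r [B [col [r_inj B_out B_in B_clique col_inj]]]] :=
  elimination_structure bag_dec bag_small.
have B_lt u v : u \in B v -> r u < r v by case/B_out.
have B_bag u v : u \in B v -> exists2 t, u \in bag t & v \in bag t by case/B_out.
have B_edge u v : edge u v -> r u < r v -> u \in B v.
  have [_ _ bag_edge _] := bag_dec.
  by move=> /bag_edge[t ut vt]; apply: B_in ut vt.
have pos_inj := bij_inj pos_bij.
pose em := embed col pos f B_lt.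
have em_inj : injective em by apply: embed_inj.
have em_edge x y : edge (em x) (em y) = edge x y by apply: embed_edge.
have G_blowup : iso_induced_subgraph G (strong_product P (blowup col B_lt)).
  exact: embedding_iso_induced em_inj em_edge.
have cw_blowup := blowup_cw_expr r_inj B_lt B_clique col_inj.
split=> //.
  have tw_blowup := blowup_tree_width col B_lt B_bag bag_dec bag_small.
  (* If [M] is empty, so is [G]; as no expression has an empty value, a single vertex then serves as
     [M1]. *)
  case: (pickP M) => [v _|M_empty].
    exists (blowup col B_lt), (blowup col B_lt); split=> //.
    exact: least_at_most_intro (cw_blowup v) (leqnn _).
  have G_empty (x : G) : False by have := M_empty (f x).2.
  exists (new_vertex tt), (blowup col B_lt); split=> //.
    apply: least_at_most_intro (leqnn _); rewrite bound_eq.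
    exists (CVertex (Ordinal (expn_gt0 2 (3 * k + 5)))); exact: iso_refl.
  apply: (embedding_iso_induced (f := fun x => match G_empty x with end)) => x.
    by case: (G_empty x).
  by case: (G_empty x).
case/card_gt0P => x0 _; have [e [g g_bij g_edge]] := cw_blowup (f x0).2.
(* On pairs of a position and a vertex of [e], the edges given by [hcw_of_cw] are those of
   [edge_copy_of]. *)
pose h x : add_loops P * cw_value e := ((f x).1, g (em x).2).
have [|e' [h' [h'_inj h'_in h'_onto h'_edge _]]] := @hcw_of_cw (add_loops P) _ e [set h x | x in G] _.
  by apply/set0Pn; exists (h x0); apply: imset_f.
apply: (least_at_most_intro (m := 4 * 8 ^ (k + 1))); last by rewrite bound_eq.
split; first by rewrite bound_eq expn_gt0.
exists (add_loops P); first by exists P => //; exact: iso_refl.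
exists e'.
have h_inj : injective h.
  move=> x y [eq1 /(bij_inj g_bij) eq2]; apply: em_inj.
  by rewrite /em /embed eq1; congr (_, _).
have /fin_all_exists[j jE] x : exists y, h x = h' y by apply: h'_onto; apply: imset_f.
exists j.
  have j_inj : injective j by move=> x y eq_j; apply: h_inj; rewrite !jE eq_j.
  apply: inj_card_bij => //; rewrite -(card_codom j_inj).
  apply/subset_leq_card/subsetP => y _; have /imsetP[x _ eq_y] := h'_in y.
  by apply/codomP; exists x; apply: h'_inj; rewrite -jE.
move=> x y; rewrite h'_edge -!jE /= g_edge.
by rewrite (edge_copy_of r_inj B_edge col_inj pos_inj pos_edge f_inj f_edge).
Qed.
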